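(* The map $P:M_d(n,d)\to\mathbb{C}^{m+1}\setminus\{0\}$, $P(A)=(\det A_{\lambda^0},\dots,\det A_{\lambda^m})$, induces a (weighted Plücker) embedding $$Pl_w:\mathrm{WGr}(d,n)\to\mathbb{W}P(c_0,c_1,\dots,c_m),\qquad Pl_w([A]_{\sim_w})=[\det(A_{\lambda^0}):\det(A_{\lambda^1}):\cdots:\det(A_{\lambda^m})]_{\sim_c}.$$
   Context: Fix integers $1\le d<n$, $W=(w_1,\dots,w_n)\in(\mathbb{Z}_{\ge 0})^n$ and an integer $a\ge 1$. Let $M_d(n,d)$ be the set of complex $n\times d$ matrices of rank $d$. For $A,B\in M_d(n,d)$ write $A\sim_w B$ if $B=\mathrm{diag}(t^{w_1},\dots,t^{w_n})\,A\,T$ for some $T\in \mathrm{GL}(d,\mathbb{C})$ and $t\in\mathbb{C}^*$ with $t^a=\det(T)$. The weighted Grassmann orbifold is $\mathrm{WGr}(d,n):=M_d(n,d)/\!\sim_w$ with the quotient topology; $[A]_{\sim_w}$ is the class of $A$. A Schubert symbol for $d<n$ is a sequence of integers $\lambda=(\lambda_1,\dots,\lambda_d)$ with $1\le\lambda_1<\cdots<\lambda_d\le n$; $\lambda\preceq\mu$ if $\lambda_j\le\mu_j$ for all $j$. Put $m:=\binom{n}{d}-1$ and fix a total order $\lambda^0<\cdots<\lambda^m$ on Schubert symbols preserving $\preceq$. For $A\in M_d(n,d)$, $A_\lambda$ is the $d\times d$ matrix with rows the $\lambda_1$-th, ..., $\lambda_d$-th rows of $A$. Put $c_i:=a+\sum_{j=1}^d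 w_{\lambda^i_j}\geq 1$. The weighted projective space $\mathbb{W}P(c_0,\dots,c_m)$ is the quotient of $\mathbb{C}^{m+1}\setminus\{0\}$ by the $\mathbb{C}^*$-action $t(z_0,\dots,z_m)=(t^{c_0}z_0,\dots,t^{c_m}z_m)$, with the quotient topology; $[z_0:\cdots:z_m]_{\sim_c}$ denotes the class of $(z_0,\dots,z_m)$. An embedding is a homeomorphism onto its image. *)

(* Defs.v *)
From HB Require Import structures.
From mathcomp Require Import all_boot all_order all_algebra.
From mathcomp Require Import all_classical reals topology normedtype.
From mathcomp Require Import complex.

Set Implicit Arguments.
Unset Strict Implicit.
Unset Printing Implicit Defensive.

Import Order.TTheory GRing.Theory Num.Theory.
Import numFieldNormedType.Exports.

Local Open Scope classical_set_scope.
Local Open Scope quotient_scope.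
Local Open Scope ring_scope.

(* Typed as a numClosedFieldType, so that complexes R (unlike the bare R[i])
   inherits the topology given by the modulus. *)
Definition complexes (R : realType) : numClosedFieldType := R[i].

Section Embedding.
Context {X Y : topologicalType}.

Definition homeomorphism (f : X -> Y) : Prop :=
  continuous f /\
  exists g : Y -> X, [/\ cancel f g, cancel g f & continuous g].

Definition corestrict (f : X -> Y) (x : X) : set_type (range f) :=
  SigSub (mem_set (imageT f x)).

End Embedding.

(* set_type (range f) carries the subspace topology. *)
Definition embedding (X Y : topologicalType) (f : X -> Y) : Prop :=
  homeomorphism (corestrict f).

(* Indices run over {0, ..., n-1} instead of {1, ..., n}. *)
Record schubert (n d : nat) := Schubert {
  schubert_fun :> {ffun 'I_d -> 'I_n};
  schubert_incr : [forall j : 'I_d, forall k : 'I_d,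
    (j < k)%N ==> (schubert_fun j < schubert_fun k)%N] }.

HB.instance Definition _ n d := [isSub for @schubert_fun n d].
HB.instance Definition _ n d := [Finite of schubert n d by <:].

Definition schubert_le (n d : nat) (l mu : schubert n d) : Prop :=
  forall j : 'I_d, (l j <= mu j)%N.

Definition plucker_weight (n d : nat) (W : 'I_n -> nat) (a : nat)
  (l : schubert n d) : nat := (a + \sum_(j < d) W (l j))%N.

Section WeightedGrassmann.
Variables (R : realType) (n d : nat) (W : 'I_n -> nat) (a : nat).
Local Notation C := (complexes R).

Definition full_rank : Type := set_type [set A : 'M[C]_(n, d) | \rank A = d].
HB.instance Definition _ := Topological.on full_rank.
HB.instance Definition _ := SubType.on full_rank.

Definition weight_mx (t : C) : 'M[C]_n := diag_mx (\row_i t ^+ W i).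

Definition wgr_sim (A B : full_rank) : Prop :=
  exists (T : 'M[C]_d) (t : C),
    [/\ T \in unitmx, t != 0, t ^+ a = \det T
      & \val B = weight_mx t *m \val A *m T].

Lemma weight_mx1 : weight_mx 1 = 1%:M.
Proof.
rewrite -diag_const_mx; congr diag_mx; apply/rowP => i.
by rewrite !mxE expr1n.
Qed.

Lemma weight_mxM s t : weight_mx (s * t) = weight_mx s *m weight_mx t.
Proof.
rewrite mulmx_diag; congr diag_mx; apply/rowP => i.
by rewrite !mxE exprMn.
Qed.

Lemma wgr_sim_refl A : wgr_sim A A.
Proof.
exists 1%:M, 1; split; rewrite ?unitmx1 ?oner_eq0 ?expr1n ?det1//.
by rewrite weight_mx1 mul1mx mulmx1.
Qed.

Lemma wgr_sim_sym A B : wgr_sim A B -> wgr_sim B A.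
Proof.
move=> [T [t [uT t0 tT eB]]]; exists (invmx T), t^-1; split.
- by rewrite unitmx_inv.
- by rewrite invr_eq0.
- by rewrite det_inv exprVn tT.
- by rewrite eB !mulmxA -weight_mxM mulVf// weight_mx1 mul1mx mulmxK.
Qed.

Lemma wgr_sim_trans B A D : wgr_sim A B -> wgr_sim B D -> wgr_sim A D.
Proof.
move=> [T [t [uT t0 tT eB]]] [S [s [uS s0 sS eD]]]; exists (T *m S), (s * t).
split.
- by rewrite unitmx_mul uT.
- by rewrite mulf_neq0.
- by rewrite exprMn det_mulmx tT sS mulrC.
- by rewrite eD eB weight_mxM !mulmxA.
Qed.

Definition wgr_rel : rel full_rank := fun A B => `[< wgr_sim A B >].

Lemma wgr_rel_equiv : equiv_class_of wgr_rel.
Proof.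
split.
- by move=> A; apply/asboolP/wgr_sim_refl.
- by move=> A B; apply: asbool_equiv_eq; split; exact: wgr_sim_sym.
- move=> B A D /asboolP AB /asboolP BD; apply/asboolP.
  exact: wgr_sim_trans AB BD.
Qed.

Definition wgr_equiv : equiv_rel full_rank := EquivRelPack wgr_rel_equiv.

Definition WGr : Type := quotient_topology {eq_quot wgr_equiv}.
HB.instance Definition _ := Quotient.on WGr.
HB.instance Definition _ := Topological.on WGr.

End WeightedGrassmann.

Section WeightedProjective.
Variables (R : realType) (N : nat) (c : 'I_N -> nat).
Local Notation C := (complexes R).

Definition punctured : Type := set_type [set z : 'rV[C]_N | z != 0].
HB.instance Definition _ := Topological.on punctured.
HB.instance Definition _ := SubType.on punctured.

Definition wp_sim (z z' : punctured) : Prop :=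
  exists2 t : C, t != 0 & \val z' = \row_i (t ^+ c i * (\val z) 0 i).

Lemma wp_sim_refl z : wp_sim z z.
Proof.
exists 1; first exact: oner_neq0.
by apply/rowP => i; rewrite mxE expr1n mul1r.
Qed.

Lemma wp_sim_sym z z' : wp_sim z z' -> wp_sim z' z.
Proof.
move=> [t t0 ez']; exists t^-1; first by rewrite invr_eq0.
by apply/rowP => i; rewrite mxE ez' mxE mulrA -exprMn mulVf// expr1n mul1r.
Qed.

Lemma wp_sim_trans z' z z'' : wp_sim z z' -> wp_sim z' z'' -> wp_sim z z''.
Proof.
move=> [t t0 ez'] [s s0 ez'']; exists (s * t); first exact: mulf_neq0.
by apply/rowP => i; rewrite ez'' ez' !mxE mulrA exprMn.
Qed.

Definition wp_rel : rel punctured := fun z z' => `[< wp_sim z z' >].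

Lemma wp_rel_equiv : equiv_class_of wp_rel.
Proof.
split.
- by move=> z; apply/asboolP/wp_sim_refl.
- by move=> z z'; apply: asbool_equiv_eq; split; exact: wp_sim_sym.
- move=> z' z z'' /asboolP zz' /asboolP zz''; apply/asboolP.
  exact: wp_sim_trans zz' zz''.
Qed.

Definition wp_equiv : equiv_rel punctured := EquivRelPack wp_rel_equiv.

Definition WP : Type := quotient_topology {eq_quot wp_equiv}.
HB.instance Definition _ := Quotient.on WP.
HB.instance Definition _ := Topological.on WP.

End WeightedProjective.

(* Main.v *)
Require Import Defs.
From mathcomp Require Import all_boot all_order all_algebra.
From mathcomp Require Import all_classical reals topology normedtype.
From mathcomp Require Import perm complex.
Import Order.TTheory GRing.Theory Num.Theory.
Import numFieldNormedType.Exports.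
Local Open Scope classical_set_scope.
Local Open Scope quotient_scope.
Local Open Scope ring_scope.

(* On the chart where the i-th Plücker coordinate z_i is nonzero, Cramer's rule
   gives a continuous s with s (P A) = A T, det T = 1.  Hence P separates
   SL_d-orbits; since P carries ~w-orbits onto weighted C^*-orbits of the cone
   P(M_d(n, d)), the induced map is injective.  It is open onto its image
   because the C^*-saturation of the open set {z | z_i != 0, s z in V} is open
   in the weighted projective space and meets the image only in classes of
   elements of V. *)

(** * Algebra of Plücker coordinates over a field *)

Lemma schubert_sort {n d : nat} (f : 'I_d -> 'I_n) : injective f ->
  exists (l : schubert n d) (s : 'S_d), f =1 l \o s.
Proof.
(* [E] lists the image of [f]; [l] will read this list off, and [s] will send [j] to the position of
   [f j] in it. *)
move=> f_inj; pose E := enum [set f j | j : 'I_d]%SET.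
have sizeE : size E = d by rewrite -cardE card_imset// card_ord.
(* No sorting is required: [enum] filters the enumeration of ['I_n], whose values form the
   increasing list [iota 0 n]. *)
have incrE : sorted ltn (map val E).
  rewrite /E -[enum _](eq_filter (mem_enum _)).
  rewrite -(eq_filter (mem_map val_inj _)) -filter_map.
  by rewrite (sorted_filter ltn_trans) // unlock val_ord_enum iota_ltn_sorted.
pose tE : d.-tuple 'I_n := Tuple (introT eqP sizeE).
pose l : {ffun 'I_d -> 'I_n} := [ffun j => tnth tE j].
have l_incr : [forall j : 'I_d, forall k : 'I_d, (j < k)%N ==> (l j < l k)%N].
  apply/forallP => j; apply/forallP => k; apply/implyP => jk; rewrite !ffunE.
  rewrite !(tnth_nth (l j)) /=.
  have ltE (i : 'I_d) : (i < size E)%N by rewrite sizeE.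
  rewrite -(nth_map (l j) 0%N val (ltE j)) -(nth_map (l j) 0%N val (ltE k)).
  by apply: (sorted_ltn_nth ltn_trans 0%N incrE); rewrite ?inE ?size_map.
have idxE j : (index (f j) E < d)%N.
  by rewrite -[X in (_ < X)%N]sizeE index_mem mem_enum imset_f.
pose g j := Ordinal (idxE j).
have fE j : f j = l (g j).
  by rewrite ffunE (tnth_nth (f j)) /= nth_index// mem_enum imset_f.
have g_inj : injective g by move=> j k gjk; apply: f_inj; rewrite !fE gjk.
by exists (Schubert l_incr), (perm g_inj) => j /=; rewrite permE fE.
Qed.

Section PluckerCoordinates.
Context {F : fieldType} {n d N : nat} (lam : 'I_N -> schubert n d).
Hypothesis lam_surj : forall l, exists i, lam i = l.
Implicit Type A : 'M[F]_(n, d).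

Definition plucker A : 'rV[F]_N := \row_i \det (rowsub (lam i) A).

(** Sorting the rows costs the sign of a permutation, and a repeated row makes the minor vanish. The
    coefficient and the index depend on [f] alone, so the resulting formulas are uniform in [A]. *)
Lemma plucker_det (i0 : 'I_N) (f : 'I_d -> 'I_n) :
  exists ej : F * 'I_N, forall A, \det (rowsub f A) = ej.1 * plucker A 0 ej.2.
Proof.
have [/injectiveP f_inj|/injectivePn[j [k jk fjk]]] := boolP (injectiveb f).
  have [l [s fE]] := schubert_sort f f_inj; have [i lE] := lam_surj l.
  exists ((-1) ^+ s, i) => A; rewrite mxE lE -det_perm -det_mulmx -row_permE.
  by congr (\det _); apply/matrixP => j k; rewrite !mxE fE.
(* The coefficient is 0 for a repeated row, so [i0] is a mere default index. *)
exists (0, i0) => A; rewrite mul0r; apply: (determinant_alternate jk) => p.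
by rewrite !mxE fjk.
Qed.

Lemma plucker_neq0 A : \rank A = d -> plucker A != 0.
Proof.
move=> /eqP rA; apply/eqP => PA0.
have := fullrowsub_unit rA; rewrite unitmxE unitfE => /negP[].
(* This only produces an element [i] of ['I_N], the default index that [plucker_det] asks for. *)
have [l [s fE]] := schubert_sort _ (@fullrankfun_inj _ _ _ _ rA).
have [i lE] := lam_surj l.
have [[e j] ->] := plucker_det i (fullrankfun rA).
by rewrite PA0 mxE mulr0.
Qed.

Lemma plucker_diag_mul (D : 'rV[F]_n) A (T : 'M[F]_d) i :
  plucker (diag_mx D *m A *m T) 0 i =
  \prod_j D 0 (lam i j) * \det T * plucker A 0 i.
Proof.
have -> : \prod_j D 0 (lam i j) = \det (diag_mx (\row_j D 0 (lam i j))).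
  by rewrite det_diag; apply: eq_bigr => j _; rewrite mxE.
rewrite /plucker !mxE mulrAC -!det_mulmx; congr (\det _).
rewrite -mul_rowsub_mx; congr (_ *m T).
by apply/matrixP => j k; rewrite mxE !mul_diag_mx !mxE.
Qed.

Definition exchange (l : 'I_d -> 'I_n) (k : 'I_d) (i : 'I_n) : 'I_d -> 'I_n :=
  fun j => if j == k then i else l j.

(** Cramer's rule: in the Laplace expansion along row [k] the cofactors ignore row [k], so they are
    unchanged when that row is replaced by row [i] of [A]. *)
Lemma mulmx_adj_rowsub A (l : 'I_d -> 'I_n) i k :
  (A *m \adj (rowsub l A)) i k = \det (rowsub (exchange l k i) A).
Proof.
rewrite mxE (expand_det_row _ k); apply: eq_bigr => j _.
rewrite !mxE /exchange eqxx; congr (_ * (_ * \det _)).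
by apply/matrixP => p q; rewrite !mxE eq_sym (negPf (neq_lift _ _)).
Qed.

(* On the chart z_i != 0, A is recovered up to SL_d as
   A (A_(lam i))^-1 diag(z_i, 1, ..., 1), whose entries are, by Cramer's rule,
   ratios of Plücker coordinates. *)
Lemma plucker_section (i : 'I_N) (k0 : 'I_d) :
  exists (e : 'I_n -> 'I_d -> F) (r : 'I_n -> 'I_d -> 'I_N),
    forall A, plucker A 0 i != 0 ->
      exists2 T : 'M[F]_d, \det T = 1 & A *m T = \matrix_(p, k)
        ((plucker A 0 i)^-1 * (e p k * plucker A 0 (r p k)) *
          (if k == k0 then plucker A 0 i else 1)).
Proof.
(* Choosing coefficients and indices before [A] is introduced makes the section one fixed formula in
   the coordinates. *)
have /choice[h hE] : forall pk : 'I_n * 'I_d, exists ej : F * 'I_N, forall A,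
    \det (rowsub (exchange (lam i) pk.2 pk.1) A) = ej.1 * plucker A 0 ej.2.
  by move=> pk; exact: plucker_det.
exists (fun p k => (h (p, k)).1), (fun p k => (h (p, k)).2) => A zi0.
have detE : \det (rowsub (lam i) A) = plucker A 0 i by rewrite mxE.
(* [D] has the determinant of the chart minor, so it compensates the inverse of that minor and [T]
   has determinant 1. *)
pose D : 'M[F]_d := diag_mx (\row_k (if k == k0 then plucker A 0 i else 1)).
have detD : \det D = plucker A 0 i.
  rewrite det_diag (bigD1 k0)//= mxE eqxx big1 ?mulr1// => k /negPf kk0.
  by rewrite mxE kk0.
exists (invmx (rowsub (lam i) A) *m D).
  by rewrite det_mulmx det_inv detD detE mulVf.
have uA : rowsub (lam i) A \in unitmx by rewrite unitmxE unitfE detE.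
apply/matrixP => p k; rewrite mulmxA mul_mx_diag.
rewrite [LHS]mxE [RHS]mxE [X in _ * X]mxE.
rewrite -(hE (p, k)) /= -mulmx_adj_rowsub /invmx uA -scalemxAr detE.
by congr (_ * _); rewrite mxE.
Qed.

End PluckerCoordinates.

(** * Continuity into subspaces and matrices, and a criterion for embeddings *)

Lemma initial_topology_continuous_at {X T : topologicalType} {S : choiceType}
    (g : S -> T) (f : X -> initial_topology g) (x : X) :
  continuous_at x (g \o f) -> continuous_at x f.
Proof.
move=> gf U [V [[W oW <-]] Wfx sVU]; apply: filterS (sVU) _ => //.
by apply: gf; apply: open_nbhs_nbhs.
Qed.

Lemma matrix_continuous_at {X T : topologicalType} {p q : nat}
    (f : X -> 'M[T]_(p, q)) (x : X) :
  (forall i j, continuous_at x (fun y => f y i j)) -> continuous_at x f.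
Proof.
move=> fc U [V nV sVU]; apply: (filterS sVU).
have : \forall y \near x, forall ij : 'I_p * 'I_q, V ij.1 ij.2 (f y ij.1 ij.2).
  by apply: filter_forall => -[i j]; exact: fc.
by apply: filterS => y Vfy i j; exact: (Vfy (i, j)).
Qed.

Lemma det_continuous {K : numFieldType} {d : nat} :
  continuous (fun A : 'M[K]_d => \det A).
Proof.
apply: (continuous_big add_continuous) => s _ A.
have prod_cont : continuous (fun B : 'M[K]_d => \prod_i B i (s i)).
  by apply: (continuous_big mul_continuous) => i _; exact: coord_continuous.
apply: (@continuousM K _ (fun=> (-1) ^+ s) _ A); last exact: prod_cont.
exact: cst_continuous.
Qed.

(** The last hypothesis is openness onto the image in local form; it says that the inverse is
    continuous for the subspace topology of [range f]. *)
Lemma open_injection_embedding {X Y : topologicalType} (f : X -> Y) :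
  continuous f -> injective f ->
  (forall x U, nbhs x U -> exists2 V, nbhs (f x) V & f @^-1` V `<=` U) ->
  embedding f.
Proof.
move=> fc f_inj f_open; split.
  by move=> x; apply: initial_topology_continuous_at; exact: fc.
have /choice[g fg] : forall y : set_type (range f), exists x, f x = \val y.
  by move=> [y /= /set_mem[x _ <-]]; exists x.
exists g; split.
- by move=> x; apply: f_inj; rewrite fg.
- by move=> y; apply: val_inj => /=; rewrite fg.
move=> y U /f_open[V]; rewrite fg => nV sVU.
have : nbhs y (\val @^-1` V) by exact: initial_continuous.
by apply: filterS => y' Vy'; apply: sVU; rewrite /= fg.
Qed.

(** * Classes and open sets in the quotients, and continuity of the coordinates *)

Lemma WGr_piP {R : realType} {n d : nat} (W : 'I_n -> nat) (a : nat)
    (A B : full_rank R n d) :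
  \pi_(WGr R d W a) A = \pi_(WGr R d W a) B <-> wgr_sim W a A B.
Proof.
split=> [/(eqmodP (@wgr_equiv R n d W a))/asboolP//|AB].
by apply/(eqmodP (@wgr_equiv R n d W a))/asboolP.
Qed.

Lemma WP_piP {R : realType} {N : nat} (c : 'I_N -> nat) (z z' : punctured R N) :
  \pi_(WP R c) z = \pi_(WP R c) z' <-> wp_sim c z z'.
Proof.
split=> [/(eqmodP (@wp_equiv R N c))/asboolP//|zz'].
by apply/(eqmodP (@wp_equiv R N c))/asboolP.
Qed.

Lemma weighted_scale_continuous {K : numFieldType} {N : nat}
    (c : 'I_N -> nat) (t : K) :
  continuous (fun z : 'rV[K]_N => \row_i (t ^+ c i * z 0 i)).
Proof.
move=> z; apply: matrix_continuous_at => i j.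
have -> : (fun y : 'rV[K]_N => (\row_i0 (t ^+ c i0 * y 0 i0)) i j) =
    (fun y => t ^+ c j * y 0 j).
  by apply/funext => y; rewrite mxE.
apply: (@continuousM K _ (fun=> t ^+ c j) (fun y : 'rV[K]_N => y 0 j) z).
  exact: cst_continuous.
exact: coord_continuous.
Qed.

(** The projection of a group action is open: the saturation of an open set is a union of preimages
    under the continuous scalings. *)
Lemma WP_open_image {R : realType} {N : nat} (c : 'I_N -> nat)
    (Q : set 'rV[complexes R]_N) :
  open Q -> open (\pi_(WP R c) @` [set z | Q (\val z)]).
Proof.
move=> oQ; pose act (t : complexes R) (z : 'rV[complexes R]_N) : 'rV_N :=
  \row_i (t ^+ c i * z 0 i).
have act_cont t : continuous (act t) by exact: weighted_scale_continuous.
rewrite /open /= /quotient_open.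
(* Openness in the subspace [punctured] is witnessed by an ambient open set, here the saturation of
   [Q]. *)
exists (\bigcup_(t in [set t : complexes R | t != 0]) (act t @^-1` Q)).
  by apply: bigcup_open => t _; exact: open_comp.
apply/seteqP; split => z /=.
  move=> [t t0 Qtz].
  have tz0 : act t (\val z) != 0.
    apply/eqP => /rowP tz0; have /set_mem/= /eqP[] := valP z.
    apply/rowP => i; apply/eqP; have /eqP := tz0 i; rewrite !mxE.
    by rewrite mulf_eq0 expf_eq0 (negPf t0) andbF.
  have ptz : [set y : 'rV[complexes R]_N | y != 0] (act t (\val z)) by [].
  exists (SigSub (mem_set ptz) : punctured R N) => //.
  by apply/WP_piP/wp_sim_sym; exists t.
move=> [z' Qz' /WP_piP /wp_sim_sym [t t0 z'E]]; exists t => //=.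
by rewrite /act -z'E.
Qed.

Lemma plucker_continuous {K : numFieldType} {n d N : nat}
    (lam : 'I_N -> schubert n d) : continuous (plucker (F := K) lam).
Proof.
move=> A; apply: matrix_continuous_at => i j.
have -> : (fun B => plucker lam B i j) =
    (fun M : 'M[K]_d => \det M) \o (fun B : 'M[K]_(n, d) => rowsub (lam j) B).
  by apply/funext => B; rewrite mxE.
apply: continuous_comp; last exact: det_continuous.
apply: matrix_continuous_at => p q.
have -> : (fun B : 'M[K]_(n, d) => rowsub (lam j) B p q) =
    (fun B => B (lam j p) q).
  by apply/funext => B; rewrite mxE.
exact: coord_continuous.
Qed.

(** * The induced map between the two quotients *)

Section PluckerEmbedding.
Context {R : realType} {n d N : nat} (W : 'I_n -> nat) (a : nat).
Context (lam : 'I_N -> schubert n d).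
Hypothesis lam_surj : forall l, exists i, lam i = l.
Hypothesis d_gt0 : (0 < d)%N.
Local Notation C := (complexes R).
Local Notation c := (fun i : 'I_N => plucker_weight W a (lam i)).
Implicit Types A B : full_rank R n d.

Lemma full_rank_rank A : \rank (\val A) = d.
Proof. exact: set_mem (valP A). Qed.

(** Both factors are invertible, so the product keeps rank [d] and is again a point of
    [full_rank]. *)
Lemma wgr_sim_act A (T : 'M[C]_d) (t : C) :
  T \in unitmx -> t != 0 -> t ^+ a = \det T ->
  exists2 B, \val B = weight_mx W t *m \val A *m T & wgr_sim W a A B.
Proof.
move=> uT t0 tT.
have rB : [set M : 'M[C]_(n, d) | \rank M = d] (weight_mx W t *m \val A *m T).
  rewrite /= mxrankMfree ?row_free_unit// -mxrank_tr trmx_mul mxrankMfree.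
    by rewrite mxrank_tr full_rank_rank.
  rewrite row_free_unit unitmx_tr unitmxE unitfE det_diag.
  by apply/prodf_neq0 => i _; rewrite mxE expf_neq0.
by exists (SigSub (mem_set rB) : full_rank R n d) => //; exists T, t.
Qed.

Definition plucker_map A : punctured R N :=
  SigSub (mem_set (plucker_neq0 lam lam_surj (\val A) (full_rank_rank A)
    : [set z : 'rV[C]_N | z != 0] (plucker lam (\val A)))).

Lemma plucker_map_continuous : continuous plucker_map.
Proof.
move=> A; apply: initial_topology_continuous_at.
have -> : set_val \o plucker_map = plucker lam \o set_val by [].
apply: continuous_comp; first exact: initial_continuous.
exact: plucker_continuous.
Qed.

(** The factor [\det T] contributes [t ^+ a] and the rows selected by [lam i] contribute their
    weights; together they give the exponent [c i]. *)
Lemma plucker_weight_act (t : C) (A : 'M[C]_(n, d)) (T : 'M[C]_d) :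
  t ^+ a = \det T ->
  plucker lam (weight_mx W t *m A *m T) =
  \row_i (t ^+ c i * plucker lam A 0 i).
Proof.
move=> tT; apply/rowP => i; rewrite plucker_diag_mul [RHS]mxE -tT.
congr (_ * _); rewrite /plucker_weight addnC exprD; congr (_ * _).
by rewrite -prodrXr; apply: eq_bigr => j _; rewrite mxE.
Qed.

Lemma plucker_map_sim A B :
  wgr_sim W a A B -> wp_sim c (plucker_map A) (plucker_map B).
Proof.
by move=> [T [t [_ t0 tT BE]]]; exists t; rewrite //= BE plucker_weight_act.
Qed.

(** Every nonzero [t] occurs in the relation on matrices, through [T = diag(t^a, 1, ..., 1)]; hence
    the whole weighted orbit of a Plücker vector lifts to the class of [A]. *)
Lemma plucker_map_orbit A (z : punctured R N) : wp_sim c (plucker_map A) z ->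
  exists2 B, wgr_sim W a A B & plucker lam (\val B) = \val z.
Proof.
move=> [t t0 zE].
pose T : 'M[C]_d := diag_mx
  (\row_k (if k == Ordinal d_gt0 then t ^+ a else 1)).
have detT : \det T = t ^+ a.
  rewrite det_diag (bigD1 (Ordinal d_gt0))//= mxE eqxx big1 ?mulr1//.
  by move=> k /negPf kk0; rewrite mxE kk0.
have [||B BE AB] := wgr_sim_act A T t _ t0 => //.
  by rewrite unitmxE detT unitfE expf_neq0.
by exists B; rewrite // BE plucker_weight_act.
Qed.

(* s is a local section of plucker_map up to SL_d, hence up to wgr_sim. *)
Lemma plucker_map_section (i : 'I_N) : exists s : 'rV[C]_N -> 'M[C]_(n, d),
  (forall z : 'rV[C]_N, z 0 i != 0 -> continuous_at z s) /\
  forall A, plucker lam (\val A) 0 i != 0 ->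
    exists2 B, wgr_sim W a A B & \val B = s (plucker lam (\val A)).
Proof.
have [e [r sP]] := plucker_section (F := C) lam lam_surj i (Ordinal d_gt0).
exists (fun z => \matrix_(p, k) ((z 0 i)^-1 * (e p k * z 0 (r p k)) *
  (if k == Ordinal d_gt0 then z 0 i else 1))).
split=> [z zi0|A Ai0].
  apply: matrix_continuous_at => p k.
  have coordc j : continuous_at z (fun y : 'rV[C]_N => y 0 j).
    exact: coord_continuous.
  pose s1 (y : 'rV[C]_N) := (y 0 i)^-1 * (e p k * y 0 (r p k)).
  pose s2 (y : 'rV[C]_N) := if k == Ordinal d_gt0 then y 0 i else 1.
  rewrite [X in continuous_at _ X](_ : _ = s1 \* s2); last first.
    by apply/funext => y; rewrite mxE.
  apply: (@continuousM C _ s1 s2 z).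
    apply: (@continuousM C _ (fun y : 'rV[C]_N => (y 0 i)^-1)
      (fun y : 'rV[C]_N => e p k * y 0 (r p k)) z).
      exact: (@continuousV C _ (fun y : 'rV[C]_N => y 0 i) z zi0 (coordc i)).
    apply: (@continuousM C _ (fun=> e p k) (fun y : 'rV[C]_N => y 0 (r p k)) z).
      exact: cst_continuous.
    exact: coordc.
  by rewrite /s2; case: (k == _); [exact: coordc|exact: cst_continuous].
have [T detT AT] := sP _ Ai0.
(* As [\det T = 1], the scalar [t = 1] is admissible: orbits of the special linear group lie inside
   the classes. *)
have [|||B BE AB] := wgr_sim_act A T 1; rewrite ?oner_eq0 ?expr1n//.
  by rewrite unitmxE detT unitr1.
by exists B => //; rewrite BE weight_mx1 mul1mx AT.
Qed.

(** Moving [A] within its class makes the two Plücker vectors equal; both matrices are then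
    equivalent to the same value of the local section. *)
Lemma plucker_map_inj A B :
  wp_sim c (plucker_map A) (plucker_map B) -> wgr_sim W a A B.
Proof.
move=> /plucker_map_orbit[A' AA' A'E].
have /rV0Pn[i Bi0] := plucker_neq0 lam lam_surj _ (full_rank_rank B).
have [s [_ sP]] := plucker_map_section i.
have [B1 BB1 B1E] := sP _ Bi0.
have [|A1 A'A1] := sP A'; first by rewrite A'E.
rewrite A'E -B1E => /val_inj A1E; rewrite A1E in A'A1.
exact: wgr_sim_trans (wgr_sim_trans AA' A'A1) (wgr_sim_sym BB1).
Qed.

Definition plucker_embed (x : WGr R d W a) : WP R c :=
  \pi_(WP R c) (plucker_map (repr x)).

Lemma plucker_embed_pi A :
  plucker_embed (\pi_(WGr R d W a) A) = \pi_(WP R c) (plucker_map A).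
Proof. by apply/WP_piP/plucker_map_sim/(WGr_piP W a); rewrite reprK. Qed.

Lemma plucker_embed_continuous : continuous plucker_embed.
Proof.
apply/quotient_continuous.
have -> : plucker_embed \o \pi_(WGr R d W a) = \pi_(WP R c) \o plucker_map.
  by apply/funext => A; exact: plucker_embed_pi.
move=> A; apply: continuous_comp; first exact: plucker_map_continuous.
exact: pi_continuous.
Qed.

Lemma plucker_embed_embedding : embedding plucker_embed.
Proof.
apply: open_injection_embedding; first exact: plucker_embed_continuous.
  move=> x y /(WP_piP c)/plucker_map_inj/(WGr_piP W a).
  by rewrite !reprK.
move=> x; rewrite -[x]reprK; move: (repr x) => A U UA.
have /rV0Pn[i Ai0] := plucker_neq0 lam lam_surj _ (full_rank_rank A).
have [s [s_cont sP]] := plucker_map_section i.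
(* [A] is replaced by the representative [A1] given by the section, so that continuity of [s]
   controls a neighbourhood of it. *)
have [A1 /(WGr_piP W a) AA1 A1E] := sP _ Ai0.
have : nbhs A1 (\pi_(WGr R d W a) @^-1` U).
  by rewrite AA1 in UA; exact: pi_continuous UA.
move=> [_ [[V oV <-] VA1 sVU]].
(* [Q] collects the vectors of the chart that the section sends into [V], an ambient open set whose
   matrices of full rank have their classes in [U]. *)
pose Q : set 'rV[C]_N := [set z : 'rV[C]_N | z 0 i != 0 /\ V (s z)].
have nQ : nbhs (plucker lam (\val A)) Q.
  apply: filterI.
    have ci := @coord_continuous C _ _ 0 i (plucker lam (\val A)).
    exact: (@cvgr_neq0 C C _ _ _ _ _ ci Ai0).
  by apply: (s_cont _ Ai0); apply: open_nbhs_nbhs; split=> //; rewrite -A1E.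
(* [Q] is only known to be a neighbourhood of the Plücker vector of [A]; its interior is the open
   set to project. *)
exists (\pi_(WP R c) @` [set z | Q° (\val z)]).
  apply: open_nbhs_nbhs; split; first exact/WP_open_image/open_interior.
  by rewrite plucker_embed_pi; exists (plucker_map A).
move=> y; rewrite -[y]reprK; move: (repr y) => B /=.
rewrite plucker_embed_pi => -[z /interior_subset[zi0 Vsz]].
(* [B] is moved to [B1] with Plücker vector exactly [z], then to [B2 = s z], which lies in [V]; so
   the class of [B] is in [U]. *)
move=> /(WP_piP c)/wp_sim_sym/plucker_map_orbit[B1 BB1 B1E].
rewrite -B1E in zi0 Vsz.
have [B2 B1B2 B2E] := sP _ zi0.
have -> : \pi_(WGr R d W a) B = \pi_(WGr R d W a) B2.
  by apply/WGr_piP/(wgr_sim_trans BB1 B1B2).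
by apply: sVU; rewrite /= -[set_val B2]/(\val B2) B2E.
Qed.

End PluckerEmbedding.

Theorem lemma2p5 (R : realType) (n d : nat) (W : 'I_n -> nat) (a : nat)
    (m := 'C(n, d).-1) (lam : 'I_m.+1 -> schubert n d)
    (c := fun i : 'I_m.+1 => plucker_weight W a (lam i)) :
  (1 <= d)%N -> (d < n)%N -> (1 <= a)%N ->
  bijective lam ->
  (forall i j : 'I_m.+1, schubert_le (lam i) (lam j) -> (i <= j)%N) ->
  exists P : full_rank R n d -> punctured R m.+1,
    (forall (A : full_rank R n d) (i : 'I_m.+1),
       (\val (P A)) 0 i = \det (rowsub (lam i) (\val A))) /\
    exists Pl : WGr R d W a -> WP R c,
      (forall A : full_rank R n d, Pl (\pi_(WGr R d W a) A) = \pi_(WP R c) (P A)) /\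
      embedding Pl.
Proof.
move=> d_gt0 _ _ [g _ gK] _.
have lam_surj l : exists i, lam i = l by exists (g l).
exists (plucker_map lam lam_surj); split; first by move=> A i; rewrite mxE.
exists (plucker_embed W a lam lam_surj); split.
  exact: plucker_embed_pi.
exact: plucker_embed_embedding.
Qed.
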